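(* Let $A, u, l, d$ be as in the context with $f(d,l)=1$, let $1\le j\le m$, and let $\alpha,\beta$, $d_+(\sigma)$, $\sigma_0$, $\sigma_\zeta$, $\sigma_\eta$ be as defined in the context for this index $j$. Suppose $n\ge 2$. Then, if $$\alpha\beta \le -\frac{2}{n} \quad\text{and}\quad \max\{\alpha,-\beta\} \le -\frac{2}{n},$$ there is some $\hat\sigma < 0$ with $$\tilde g(d_+(\hat\sigma),l) \le \tilde g(d,l) - \frac{1}{4n}.$$ Moreover, either (a) $d_+(\sigma_\zeta) \ge 0$ and $f(d_+(\sigma_\zeta),l) \le 0$; or (b) $f(d_+(\sigma_0),l) > 0$ and $\mathrm{vol}(E(d_+(\sigma_0),l)) \le \mathrm{vol}(E(d,l))$; or (c) $d_+(\sigma_\eta)\ge 0$ with $f(d_+(\sigma_\eta),l) > 0$ and $$\mathrm{vol}(E(d_+(\sigma_\eta),l)) \le \exp\left(-\frac{1}{8n}\right)\mathrm{vol}(E(d,l)).$$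
   Context: Let $A$ be a real $n\times m$ matrix of rank $n$ with nonzero columns $a_1,\dots,a_m\in\mathbb{R}^n$, let $u,l\in\mathbb{R}^m$ with $l<u$ componentwise, and assume there is an $m\times m$ matrix $\Lambda\ge 0$ with $A\Lambda=-A$ and $l=-\Lambda^Tu$ (so that $l \le A^Ty$ whenever $A^Ty\le u$). Put $r := (u+l)/2$, $v := (u-l)/2$. For $d\in\mathbb{R}^m$ let $D:=\mathrm{Diag}(d)$. For $d$ with $ADA^T$ positive definite define $$\bar y := (ADA^T)^{-1}ADr,\qquad f(d,l) := r^TDA^T(ADA^T)^{-1}ADr - r^TDr + v^TDv,$$ $$p(d) := -\ln\det(ADA^T), \qquad \tilde g(d,l) := n f(d,l) + p(d) - n,$$ and, if $f(d,l)>0$, the ellipsoid $$E(d,l) := \{y\in\mathbb{R}^n : (y-\bar y)^TADA^T(y-\bar y)\le f(d,l)\}.$$ $\mathrm{vol}$ is $n$-dimensional volume. Fix $d\ge 0$ with $ADA^T$ positive definite and $f(d,l)=1$, and an index $j$. Let $\bar y$ be the center corresponding to this $(d,l)$, and let $$\gamma_j := \sqrt{a_j^T(ADA^T)^{-1}a_j},\qquad \alpha := \frac{a_j^T\bar y-u_j}{\gamma_j},\qquad \beta := \frac{a_j^T\bar y-l_j}{\gamma_j}.$$ For $\sigma<1$ let $$d_+(\sigma) := d + \frac{\sigma}{(1-\sigma)\gamma_j^2}\,e_j,$$ where $e_j$ is the $j$th coordinate vector ($A\,\mathrm{Diag}(d_+(\sigma))A^T$ is positive definite for every $\sigma<1$).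 One always has $d_j\gamma_j^2\le 1$, with equality only if replacing $d_j$ by zero makes $ADA^T$ singular. Critical values of $\sigma$: - $\sigma_0 := -\dfrac{d_j\gamma_j^2}{1-d_j\gamma_j^2}$, the value at which the $j$th component of $d_+(\sigma)$ is zero (there is no such value if $d_j\gamma_j^2=1$). - $\sigma_\zeta$, which exists only when $\alpha<-1$ and $\beta>1$, is the root closest to zero of $\sigma\mapsto f(d_+(\sigma),l)$: $$\sigma_\zeta := \begin{cases} 2\,\dfrac{1+\alpha\beta+\sqrt{(1-\alpha^2)(1-\beta^2)}}{(\alpha+\beta)^2} & \text{if } \alpha+\beta\ne0,\\[2mm] (1-\alpha^2)^{-1} & \text{if } \alpha+\beta=0.\end{cases}$$ - $\sigma_\eta$, a stationary point of $\sigma\mapsto n\ln f(d_+(\sigma),l)+p(d_+(\sigma))$ (up to a constant, twice the logarithm of the volume of $E(d_+(\sigma),l)$) when it is less than $1$ and $f(d_+(\sigma_\eta),l)>0$: if $\alpha+\beta\neq 0$, $$\sigma_\eta := \frac{2(1+\alpha\beta)+n(\alpha+\beta)^2-\rho}{(n+1)(\alpha+\beta)^2},\qquad \rho := \left(4(1-\alpha^2)(1-\beta^2)+n^2(\beta^2-\alpha^2)^2\right)^{1/2};$$ if $\alpha+\beta=0$, $\sigma_\eta := \dfrac{1+n\alpha\beta}{1+\alpha\beta} = \dfrac{1-n\beta^2}{1-\beta^2}$. An alternative that mentions a critical value is understood to include the assertion that this value exists and is less than $1$.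
   Formalization: In (a), σ_ζ is also taken to exist when α = −1 or β = 1 (but not both), where the formula gives a double root; and the ''Moreover'' part excludes α = −1, β = 1, d_jγ_j² = 1, where no critical value exists. The statement fails in such cases as written. *)

(* Defs.v *)
From HB Require Import structures.
From mathcomp Require Import all_boot all_order all_algebra.
From mathcomp Require Import all_classical all_reals all_analysis.

Set Implicit Arguments.
Unset Strict Implicit.
Unset Printing Implicit Defensive.

Import Order.TTheory GRing.Theory Num.Theory.
Import numFieldNormedType.Exports.

Local Open Scope classical_set_scope.
Local Open Scope ring_scope.

Definition posdefmx (R : realType) (n : nat) (M : 'M[R]_n) : Prop :=
  M^T = M /\ forall x : 'cV[R]_n, x != 0 -> 0 < (x^T *m M *m x) 0 0.

Definition vec_ge0 (R : realType) (m : nat) (d : 'cV[R]_m) : Prop :=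
  forall i, 0 <= d i 0.

(* The n-fold product of the one-dimensional Lebesgue measure with itself,
   lambda_0 being the unit mass at the empty tuple. *)
Fixpoint lebesgue_tuple (R : realType) (n : nat) : set (n.-tuple R) -> \bar R :=
  match n return set (n.-tuple R) -> \bar R with
  | 0 => fun S => \d_([tuple] : 0.-tuple R) S
  | n'.+1 => fun S =>
      ((@lebesgue_measure R) \x (@lebesgue_tuple R n'))%E
        [set p : R * n'.-tuple R | S [tuple of p.1 :: p.2]]
  end.

Definition vol (R : realType) (n : nat) (S : set 'cV[R]_n) : \bar R :=
  lebesgue_tuple [set t : n.-tuple R | S (\col_i tnth t i)].

Section Ellipsoid.
Context {R : realType} {n m : nat}.
Implicit Types (A : 'M[R]_(n, m)) (u l d : 'cV[R]_m).

Definition Diag d : 'M[R]_m := diag_mx d^T.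

Definition ADAt A d : 'M[R]_n := A *m Diag d *m A^T.

Definition midpt u l : 'cV[R]_m := 2^-1 *: (u + l).

Definition halfwidth u l : 'cV[R]_m := 2^-1 *: (u - l).

Definition center A u d l : 'cV[R]_n :=
  invmx (ADAt A d) *m A *m Diag d *m midpt u l.

Definition fval A u d l : R :=
  let r := midpt u l in
  let v := halfwidth u l in
  (r^T *m Diag d *m A^T *m invmx (ADAt A d) *m A *m Diag d *m r) 0 0
  - (r^T *m Diag d *m r) 0 0 + (v^T *m Diag d *m v) 0 0.

Definition pval A d : R := - ln (\det (ADAt A d)).

Definition gtilde A u d l : R := n%:R * fval A u d l + pval A d - n%:R.

Definition ellipsoid A u d l : set 'cV[R]_n :=
  [set y | ((y - center A u d l)^T *m ADAt A d *m (y - center A u d l)) 0 0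
           <= fval A u d l].

Definition gamma A d (j : 'I_m) : R :=
  Num.sqrt (((col j A)^T *m invmx (ADAt A d) *m col j A) 0 0).

Definition alpha A u d l (j : 'I_m) : R :=
  (((col j A)^T *m center A u d l) 0 0 - u j 0) / gamma A d j.

Definition beta A u d l (j : 'I_m) : R :=
  (((col j A)^T *m center A u d l) 0 0 - l j 0) / gamma A d j.

Definition dplus A d (j : 'I_m) (sigma : R) : 'cV[R]_m :=
  d + (sigma / ((1 - sigma) * gamma A d j ^+ 2)) *: delta_mx j 0.

End Ellipsoid.

Section CriticalValues.
Context {R : realType}.
Implicit Types a b delta : R.

(* [delta] stands for d_j gamma_j^2. *)
Definition sigma0_exists delta : Prop := delta != 1.

Definition sigma0 delta : R := - (delta / (1 - delta)).

(* The numerator (1 - sigma) f of f along sigma |-> d_+(sigma) is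
   1 - (1 + a b) sigma + ((a + b) / 2)^2 sigma^2.  For a < 0 < b it has a root
   less than 1 exactly when a <= -1, 1 <= b and (a, b) <> (-1, 1).  Within this
   range its roots are negative, and they coincide when a = -1 or b = 1. *)
Definition sigma_zeta_exists a b : Prop :=
  [/\ a <= -1, 1 <= b & ~ (a = -1 /\ b = 1)].

Definition sigma_zeta a b : R :=
  if a + b == 0 then (1 - a ^+ 2)^-1
  else 2 * ((1 + a * b + Num.sqrt ((1 - a ^+ 2) * (1 - b ^+ 2)))
            / (a + b) ^+ 2).

(* The radicand of rho is nonnegative for all a and b as soon as n >= 1. *)
Definition rho (n : nat) a b : R :=
  Num.sqrt (4 * (1 - a ^+ 2) * (1 - b ^+ 2)
            + n%:R ^+ 2 * (b ^+ 2 - a ^+ 2) ^+ 2).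

Definition sigma_eta_exists a b : Prop := a + b = 0 -> 1 + a * b != 0.

Definition sigma_eta (n : nat) a b : R :=
  if a + b == 0 then (1 + n%:R * (a * b)) / (1 + a * b)
  else (2 * (1 + a * b) + n%:R * (a + b) ^+ 2 - rho n a b)
       / ((n%:R + 1) * (a + b) ^+ 2).

(* Then f(d_+(sigma)) = 1 / (1 - sigma) and none of sigma_0, sigma_zeta and
   sigma_eta exists: their formulas all divide by zero. *)
Definition no_critical_value a b delta : Prop :=
  [/\ a = -1, b = 1 & delta = 1].

End CriticalValues.

(* Main.v *)
Require Import Defs.
From HB Require Import structures.
From mathcomp Require Import all_boot all_order all_algebra.
From mathcomp Require Import all_classical all_reals all_analysis.
From mathcomp Require Import measurable_realfun ring lra.

(* Write x = - sigma.  A rank-one update of the inverse and of the determinant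
   gives f(d_+) = phi(x) / (1 + x) with phi quadratic, and divides
   det (A D A^T) by 1 + x.  Slicing and completing the square show that the
   squared volume of the ellipsoid is proportional to f^n / det (A D A^T), so it
   is multiplied by phi(x)^n / (1 + x)^(n - 1).  An explicit small x decreases
   n f + p by 1/(4n).  If phi has a root, sigma_zeta works unless sigma_0 is
   reached first, and then phi(x_0) <= 1 by convexity.  Otherwise sigma_eta is the
   global minimum of the volume over x >= 0, hence at least as good as the
   explicit step, unless sigma_0 is reached first, and then the volume has been
   decreasing all the way to x_0. *)

Set Implicit Arguments.
Unset Strict Implicit.
Unset Printing Implicit Defensive.

Import Order.TTheory GRing.Theory Num.Theory.
Import numFieldNormedType.Exports.

Local Open Scope classical_set_scope.
Local Open Scope ring_scope.

(** * Scalar inequalities along the line of updates *)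

Section ScalarStep.
Context {R : realType}.
Implicit Types (a b x y : R).

(* With [x = - sigma] and [f d = 1], [f (d_+ sigma) = phi a b x / (1 + x)]. *)
Definition phi a b x : R := 1 + (1 + a * b) * x + ((a + b) / 2) ^+ 2 * x ^+ 2.

(* A positive multiple, where [phi > 0], of the derivative of
   [phi ^ n / (1 + x) ^ (n - 1)]. *)
Definition dphi (n : nat) a b x : R :=
  n%:R * (1 + a * b + 2 * ((a + b) / 2) ^+ 2 * x) * (1 + x)
  - (n%:R - 1) * phi a b x.

(** Multiplying the inductive hypothesis by [t] leaves the surplus [n (t - 1)^2]. *)
Lemma bernoulli_le (n : nat) (t : R) : 0 <= t -> 1 + n%:R * (t - 1) <= t ^+ n.
Proof.
move=> t0; elim: n => [|n IH]; first by rewrite mul0r addr0 expr0.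
rewrite exprS; apply: (le_trans _ (ler_wpM2l t0 IH)).
rewrite -natr1 -subr_ge0.
have -> : t * (1 + n%:R * (t - 1)) - (1 + (n%:R + 1) * (t - 1))
  = n%:R * (t - 1) ^+ 2 by ring.
by rewrite mulr_ge0 ?ler0n// sqr_ge0.
Qed.

(* Convexity of [phi] bounds [phi y] below by its tangent at [x]; Bernoulli's
   inequality for [t] then handles the powers. *)
Lemma phi_ratio_le (n : nat) a b x y : (0 < n)%N -> 0 < phi a b x ->
  0 <= phi a b y -> 0 <= x -> 0 <= y -> 0 <= dphi n a b x * (y - x) ->
  phi a b x ^+ n * (1 + y) ^+ n.-1 <= phi a b y ^+ n * (1 + x) ^+ n.-1.
Proof.
case: n => // n _ px py x0 y0 Nx /=.
have x1 : 0 < 1 + x by lra.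
have y1 : 0 < 1 + y by lra.
(* The two sides differ by [dphi] at [x] times [y - x] plus a second-order Taylor term, which is
   shown nonnegative first. *)
have key : phi a b x * (n%:R * (1 + y) + (1 + x)) <=
  n.+1%:R * phi a b y * (1 + x).
  have : 0 <= n.+1%:R * ((a + b) / 2) ^+ 2 * (y - x) ^+ 2 * (1 + x)
    by rewrite (mulr_ge0 _ (ltW x1))// mulr_ge0 ?sqr_ge0// mulr_ge0 ?sqr_ge0.
  move: Nx; rewrite /dphi /phi -[n.+1%:R]natr1; lra.
(* [t] is the ratio of the values of [f] at [y] and at [x]; in terms of it the claim reads
   [(1 + x) / (1 + y) <= t ^+ n.+1]. *)
pose t := phi a b y * (1 + x) / (phi a b x * (1 + y)).
have t0 : 0 <= t by rewrite divr_ge0// mulr_ge0// ltW.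
have pxy : 0 < phi a b x * (1 + y) by rewrite mulr_gt0.
have ht : (1 + x) / (1 + y) <= t ^+ n.+1.
  apply: le_trans (bernoulli_le _ t0).
  have -> : 1 + n.+1%:R * (t - 1) =
    (phi a b x * (1 + y) + n.+1%:R * (phi a b y * (1 + x)
       - phi a b x * (1 + y))) / (phi a b x * (1 + y)).
    by rewrite /t; field; rewrite !gt_eqF.
  rewrite ler_pdivlMr// (mulrC (phi a b x)) mulrA divfK ?gt_eqF//.
  by move: key; rewrite -[n.+1%:R]natr1; lra.
have := ler_wpM2l (exprn_ge0 n.+1 (ltW pxy)) ht.
rewrite -exprMn /t (mulrC _ (_ / _)) [in X in _ <= X](mulrC (phi a b x * _)).
rewrite divfK ?gt_eqF// !exprMn !(exprS (1 + _)).
have -> : (1 + x) / (1 + y) * (phi a b x ^+ n.+1 * ((1 + y) * (1 + y) ^+ n)) =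
   (1 + x) * (phi a b x ^+ n.+1 * (1 + y) ^+ n) by field; rewrite gt_eqF.
by rewrite (mulrCA _ (1 + x)) ler_pM2l.
Qed.

(** Opposite signs make [|a + b|] at most the larger of [- a] and [b]. Twice either of them is at
    most [n |a b|], because the other is at least [2 / n]. *)
Lemma asymmetry_le (n : nat) a b : (0 < n)%N -> a <= - (2 / n%:R) ->
  2 / n%:R <= b -> ((a + b) / 2) ^+ 2 <= n%:R ^+ 2 * (a * b) ^+ 2 / 16.
Proof.
move=> n0 ha hb; have n0' : 0 < n%:R :> R by rewrite ltr0n.
have i0 : 0 < 2 / n%:R :> R by rewrite divr_gt0.
have ap : 2 <= n%:R * - a by rewrite -ler_pdivrMl// mulrC; lra.
have bp : 2 <= n%:R * b by rewrite -ler_pdivrMl// mulrC.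
rewrite [leRHS](_ : _ = (n%:R * (a * b) / 4) ^+ 2); last by field.
have a0 : 0 <= - a by lra.
have b0 : 0 <= b by lra.
have hb' : 0 <= b * (n%:R * - a - 2) by rewrite mulr_ge0// subr_ge0.
have ha' : 0 <= - a * (n%:R * b - 2) by rewrite mulr_ge0// subr_ge0.
rewrite -subr_ge0 subr_sqr -[leRHS]mulrNN mulr_ge0//; lra.
Qed.

(* At this [x] the bound [asymmetry_le] turns the left-hand side into at most
   [- 1 / (n + 6)]. *)
Lemma step_decrease (n : nat) a b (x := 4 / ((n%:R + 4) * (n%:R * - (a * b)))) :
  (2 <= n)%N -> a * b <= - (2 / n%:R) ->
  a <= - (2 / n%:R) -> 2 / n%:R <= b ->
  0 < x /\ n%:R * (phi a b x / (1 + x) - 1) + x <= - (4 * n%:R)^-1.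
Proof.
move=> n2 hab ha hb; have n2' : 2 <= n%:R :> R by rewrite ler_nat.
have n0 : 0 < n%:R :> R by lra.
have hS := asymmetry_le (ltnW n2) ha hb.
set P := - (a * b) in x *; have nP : 2 <= n%:R * P.
  by rewrite -ler_pdivrMl// mulrC /P; lra.
have P0 : 0 < P by rewrite -(pmulr_rgt0 _ n0); lra.
have n4 : 0 < n%:R + 4 :> R by lra.
have n6 : 0 < n%:R + 6 :> R by lra.
have x0 : 0 < x by rewrite divr_gt0// !mulr_gt0.
(* Put [w = n P x]. Then [n (phi - 1 - x)] is at most [- w + n w^2 / 16], and [x <= w / 2].
   Minimizing the sum of these bounds would give [w = 4 / n]; the smaller value [4 / (n + 4)] leaves
   room for the division by [1 + x]. *)
have hx : x * (n%:R * P) = 4 / (n%:R + 4).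
  by rewrite /x; field; rewrite !gt_eqF.
have xle : x <= 2 / (n%:R + 4).
  rewrite ler_pdivlMr// -(ler_pM2r (_ : 0 < 2))//.
  have -> : 2 * 2 = x * (n%:R + 4) * (n%:R * P).
    by rewrite mulrAC hx; field; rewrite gt_eqF.
  by rewrite ler_wpM2l// mulr_ge0 ?ltW.
split=> //.
have x1 : 0 < 1 + x by lra.
have fle : n%:R * (phi a b x - 1 - x) <=
    - ((3 * n%:R + 16) / (n%:R + 4) ^+ 2).
  have h1 : n%:R * (((a + b) / 2) ^+ 2 * x ^+ 2) <=
      n%:R * (n%:R ^+ 2 * (a * b) ^+ 2 / 16 * x ^+ 2).
    by rewrite ler_wpM2l ?(ltW n0)// ler_wpM2r// sqr_ge0.
  have h2 : n%:R * (n%:R ^+ 2 * (a * b) ^+ 2 / 16 * x ^+ 2) =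
      n%:R / (n%:R + 4) ^+ 2.
    transitivity (n%:R * (x * (n%:R * P)) ^+ 2 / 16); first by rewrite /P; field.
    by rewrite hx; field; rewrite gt_eqF.
  rewrite h2 in h1.
  have -> : - ((3 * n%:R + 16) / (n%:R + 4) ^+ 2) =
    - (x * (n%:R * P)) + n%:R / (n%:R + 4) ^+ 2.
    by rewrite hx; field; rewrite gt_eqF.
  by rewrite /phi; move: h1; rewrite /P; lra.
(* The bound is negative, so dividing by [1 + x] weakens it, at most by the factor
   [(n + 4) / (n + 6)]. *)
have hf : n%:R * (phi a b x / (1 + x) - 1) <=
    - ((3 * n%:R + 16) / ((n%:R + 4) * (n%:R + 6))).
  have -> : n%:R * (phi a b x / (1 + x) - 1) =
    n%:R * (phi a b x - 1 - x) / (1 + x) by field; rewrite gt_eqF.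
  rewrite ler_pdivrMr//; apply: le_trans fle _.
  rewrite mulNr lerN2.
  have -> : (3 * n%:R + 16) / (n%:R + 4) ^+ 2 =
    (3 * n%:R + 16) / ((n%:R + 4) * (n%:R + 6)) * (1 + 2 / (n%:R + 4)) :> R.
    by field; rewrite !gt_eqF.
  by rewrite ler_wpM2l ?lerD2l// divr_ge0 ?mulr_ge0//; lra.
apply: (le_trans (lerD hf xle)).
have -> : - ((3 * n%:R + 16) / ((n%:R + 4) * (n%:R + 6))) + 2 / (n%:R + 4) =
   - (n%:R + 6)^-1 :> R by field; rewrite !gt_eqF.
(* This is [n + 6 <= 4 n], that is [n >= 2]. *)
by rewrite lerN2 lef_pV2 ?posrE ?mulr_gt0//; lra.
Qed.

End ScalarStep.

(** * Roots and signs of [phi] and [dphi] *)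

Section CriticalPoints.
Context {R : realType}.
Implicit Types (a b x y : R).

Lemma dphiE (n : nat) a b x : dphi n a b x =
  (n%:R + 1) * ((a + b) / 2) ^+ 2 * x ^+ 2
  + (1 + a * b + 2 * n%:R * ((a + b) / 2) ^+ 2) * x + (1 + n%:R * (a * b)).
Proof. by rewrite /dphi /phi; ring. Qed.

(** [dphi] is a convex quadratic in [x] with value [1 + n a b] at 0, so it stays nonpositive between
    two points where it is nonpositive. *)
Lemma dphi_le0 (n : nat) a b x y : 1 + n%:R * (a * b) <= 0 ->
  dphi n a b x <= 0 -> 0 <= y <= x -> dphi n a b y <= 0.
Proof.
move=> C0 Nx /andP[y0 yx].
case: (eqVneq x 0) Nx yx => [->|x0] Nx yx.
  have y00 : y = 0 by lra.
  by rewrite y00 dphiE; lra.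
have x1 : 0 < x by lra.
rewrite -(pmulr_rle0 _ x1).
have h1 : y * dphi n a b x <= 0 by rewrite mulr_ge0_le0.
have h2 : (x - y) * (1 + n%:R * (a * b)) <= 0 by rewrite mulr_ge0_le0//; lra.
have h3 : 0 <= (n%:R + 1) * ((a + b) / 2) ^+ 2 * (x * y * (x - y)).
  apply: mulr_ge0; first by rewrite mulr_ge0 ?sqr_ge0// addr_ge0.
  by rewrite !mulr_ge0//; lra.
by move: h1 h2 h3; rewrite !dphiE; lra.
Qed.

(** Dividing out the root [x] leaves a linear factor whose sign gives positivity. The upper bound is
    convexity between [phi 0 = 1] and [phi x = 0]. *)
Lemma phi_before_root a b x y : phi a b x = 0 -> 0 <= y -> y < x ->
  1 + a * b + ((a + b) / 2) ^+ 2 * (x + y) < 0 -> 0 < phi a b y <= 1.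
Proof.
move=> phix y0 yx hy; have x0 : 0 < x by lra.
have -> : phi a b y = (y - x) * (1 + a * b + ((a + b) / 2) ^+ 2 * (x + y)).
  by rewrite -[LHS]subr0 -phix /phi; ring.
apply/andP; split; first by rewrite nmulr_rgt0 ?subr_lt0.
rewrite -(ler_pM2l x0) mulr1.
have h1 : 0 <= ((a + b) / 2) ^+ 2 * (x * y * (x - y)).
  by rewrite mulr_ge0 ?sqr_ge0// !mulr_ge0// ?subr_ge0 ltW.
have h2 : (x - y) * phi a b x = 0 by rewrite phix mulr0.
by move: h2; rewrite /phi; lra.
Qed.

(** The discriminant of [phi] is [(1 + a b)^2 - (a + b)^2 = (1 - a^2)(1 - b^2)], and [- sigma_zeta]
    is the smaller of the positive roots, so it does not exceed the vertex. *)
Lemma sigma_zeta_root a b (x := - sigma_zeta a b) : sigma_zeta_exists a b ->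
  [/\ 0 < x, phi a b x = 0 & forall y, 0 <= y < x -> 0 < phi a b y <= 1].
Proof.
case=> a1 b1 nab.
have ab1 : 1 + a * b <= 0 by nra.
have disc : 0 <= (1 - a ^+ 2) * (1 - b ^+ 2) by rewrite mulr_le0//; nra.
set t := Num.sqrt ((1 - a ^+ 2) * (1 - b ^+ 2)) in x *.
have t0 : 0 <= t by rewrite sqrtr_ge0.
have tE : t ^+ 2 = (1 - a ^+ 2) * (1 - b ^+ 2) by rewrite sqr_sqrtr.
suff [x0 phix hx] : [/\ 0 < x, phi a b x = 0 &
    forall y, 0 <= y < x -> 1 + a * b + ((a + b) / 2) ^+ 2 * (x + y) < 0].
  by split=> // y /andP[y0 yx]; apply: (phi_before_root phix) => //; apply: hx; rewrite y0.
rewrite /x /sigma_zeta; case: ifPn => ab0.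
  (* When [a + b = 0] the quadratic term vanishes and [phi] is affine. *)
  have bE : b = - a by move/eqP: ab0; lra.
  have a2 : 0 < a ^+ 2 - 1.
    rewrite bE in nab b1; have aN1 : a != -1.
      by apply/eqP => aE; apply: nab; split=> //; rewrite aE opprK.
    have : a < -1 by rewrite lt_neqAle aN1.
    by nra.
  split.
  - by rewrite oppr_gt0 invr_lt0; lra.
  - by rewrite /phi bE; field; rewrite lt_eqF//; lra.
  - by move=> y _; rewrite bE; nra.
have S0 : 0 < (a + b) ^+ 2 by rewrite lt_def sqrf_eq0 ab0 sqr_ge0.
have tlt : t < - (1 + a * b).
  have c0 : 0 <= - (1 + a * b) by lra.
  rewrite -ltr_sqr ?nnegrE// tE -subr_gt0.
  have -> : (- (1 + a * b)) ^+ 2 - (1 - a ^+ 2) * (1 - b ^+ 2) = (a + b) ^+ 2.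
    by ring.
  by [].
have xE : 0 < 2 * (- (1 + a * b) - t) / (a + b) ^+ 2.
  by rewrite divr_gt0// mulr_gt0//; lra.
have -> : - (2 * ((1 + a * b + t) / (a + b) ^+ 2)) =
  2 * (- (1 + a * b) - t) / (a + b) ^+ 2 by field.
split=> //.
- rewrite /phi; set s := (a + b) ^+ 2 in S0 *.
  have -> : ((a + b) / 2) ^+ 2 = s / 4 by rewrite /s; field.
  have -> : 1 + (1 + a * b) * (2 * (- (1 + a * b) - t) / s) +
     s / 4 * (2 * (- (1 + a * b) - t) / s) ^+ 2 =
     (s - (1 + a * b) ^+ 2 + t ^+ 2) / s by field; rewrite gt_eqF.
  by rewrite tE /s; apply/eqP; rewrite mulf_eq0; apply/orP; left; apply/eqP; ring.
- move=> y /andP[y0 yx]; set x' := 2 * _ / _ in yx xE *.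
  have h : (a + b) ^+ 2 * x' = 2 * (- (1 + a * b) - t).
    by rewrite /x' mulrC divfK// gt_eqF.
  have h' : (a + b) ^+ 2 * y < (a + b) ^+ 2 * x' by rewrite ltr_pM2l.
  by lra.
Qed.

(** If [1 + a b >= 0], no coefficient is negative. Otherwise [|a b| > 1], so exactly one of [|a|],
    [|b|] is below 1 and the discriminant is negative. *)
Lemma phi_gt0 a b x : a < 0 -> 0 < b -> (a > -1) || (b < 1) -> 0 <= x ->
  0 < phi a b x.
Proof.
move=> a0 b0 ab1 x0.
have [ab|ab] := leP 0 (1 + a * b).
  have h1 : 0 <= (1 + a * b) * x by rewrite mulr_ge0.
  have h2 : 0 <= ((a + b) / 2) ^+ 2 * x ^+ 2 by rewrite mulr_ge0 ?sqr_ge0.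
  by rewrite /phi; lra.
have disc : (1 - a ^+ 2) * (1 - b ^+ 2) < 0.
  case/orP: ab1 => h.
    have h1 : 0 < (a + 1) * b by rewrite mulr_gt0//; lra.
    have h2 : 0 < (1 - a) * (1 + a) by rewrite mulr_gt0//; lra.
    have h3 : 0 < (b - 1) * (1 + b) by rewrite mulr_gt0//; lra.
    by rewrite pmulr_rlt0; lra.
  have h1 : 0 < - a * (1 - b) by rewrite mulr_gt0//; lra.
  have h2 : 0 < (1 - b) * (1 + b) by rewrite mulr_gt0//; lra.
  have h3 : 0 < (- a - 1) * (1 - a) by rewrite mulr_gt0//; lra.
  by rewrite nmulr_rlt0; lra.
have S0 : 0 < (a + b) ^+ 2.
  rewrite lt_def sqrf_eq0 sqr_ge0 andbT; apply/eqP => abE.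
  have bE : b = - a by lra.
  by move: disc; rewrite bE sqrrN -expr2 ltNge sqr_ge0.
rewrite -(pmulr_rgt0 _ S0).
have : 0 <= (((a + b) ^+ 2) / 2 * x + (1 + a * b)) ^+ 2 by rewrite sqr_ge0.
by rewrite /phi; lra.
Qed.

(** [dphi] is negative at 0. If [a + b] is nonzero its leading coefficient is positive, and
    [- sigma_eta] is its unique positive root; if [a + b = 0] it is affine with slope [1 + a b]. *)
Lemma sigma_eta_root (n : nat) a b (x := - sigma_eta n a b) :
  1 + n%:R * (a * b) < 0 -> (a + b = 0 -> 0 < 1 + a * b) ->
  0 < x /\ dphi n a b x = 0.
Proof.
move=> C0 hab; rewrite /x /sigma_eta; case: ifPn => ab0.
  have := hab (eqP ab0) => ab1; rewrite -mulNr; split.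
    by rewrite divr_gt0//; lra.
  by rewrite dphiE (eqP ab0); field; rewrite gt_eqF.
have S0 : 0 < (a + b) ^+ 2 by rewrite lt_def sqrf_eq0 ab0 sqr_ge0.
have n0 : 0 < n%:R + 1 :> R by rewrite ltr_wpDl.
have A0 : 0 < (n%:R + 1) * (a + b) ^+ 2 by rewrite mulr_gt0.
set B := 2 * (1 + a * b) + n%:R * (a + b) ^+ 2.
(* The radicand of [rho] is four times the discriminant of [dphi]. *)
have rad : 4 * (1 - a ^+ 2) * (1 - b ^+ 2) + n%:R ^+ 2 * (b ^+ 2 - a ^+ 2) ^+ 2 =
  B ^+ 2 - 4 * ((n%:R + 1) * (a + b) ^+ 2) * (1 + n%:R * (a * b)).
  by rewrite /B; ring.
have radB : B ^+ 2 < B ^+ 2 - 4 * ((n%:R + 1) * (a + b) ^+ 2) * (1 + n%:R * (a * b)).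
  by rewrite ltrBrDl -ltrBrDr subrr pmulr_rlt0// mulr_gt0.
have r2 : rho n a b ^+ 2 =
  B ^+ 2 - 4 * ((n%:R + 1) * (a + b) ^+ 2) * (1 + n%:R * (a * b)).
  by rewrite /rho sqr_sqrtr rad// (le_trans (sqr_ge0 B))// ltW.
have r0 : 0 <= rho n a b by rewrite sqrtr_ge0.
have rB : `|B| < rho n a b.
  rewrite -ltr_sqr ?nnegrE// real_normK ?num_real//.
  by rewrite r2.
rewrite -mulNr opprB; split.
  by rewrite divr_gt0// subr_gt0 (le_lt_trans _ rB)// ler_norm.
set r := rho n a b in r0 r2 *; rewrite dphiE.
have -> : (n%:R + 1) * ((a + b) / 2) ^+ 2 * ((r - B) / ((n%:R + 1) * (a + b) ^+ 2)) ^+ 2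
  + (1 + a * b + 2 * n%:R * ((a + b) / 2) ^+ 2) *
     ((r - B) / ((n%:R + 1) * (a + b) ^+ 2)) + (1 + n%:R * (a * b))
  = (r ^+ 2 - (B ^+ 2 - 4 * ((n%:R + 1) * (a + b) ^+ 2) * (1 + n%:R * (a * b))))
     / (4 * ((n%:R + 1) * (a + b) ^+ 2)).
  by rewrite /B; field; rewrite ab0 gt_eqF.
by rewrite r2 subrr mul0r.
Qed.

End CriticalPoints.

(** * The three alternatives in scalar form *)

Section CriticalCases.
Context {R : realType}.
Implicit Types (a b delta : R).

(** A step that makes the updated weight negative has passed the point where that weight vanishes,
    so this point exists and comes earlier. *)
Lemma sigma0_bound delta x : 0 <= delta <= 1 -> 0 <= x -> delta * (1 + x) < x ->
  [/\ delta < 1, 0 <= - sigma0 delta & - sigma0 delta < x].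
Proof.
move=> /andP[d0 d1] x0 dx; have dlt : delta < 1.
  rewrite lt_neqAle d1 andbT; apply/eqP => dE; move: dx; rewrite dE; lra.
have d2 : 0 < 1 - delta by lra.
rewrite /sigma0 opprK; split=> //; first by rewrite divr_ge0// ltW.
by rewrite ltr_pdivrMr//; lra.
Qed.

(* [- s <= delta (1 - s)] says that [d_+ s] is nonnegative. *)
Lemma critical_cases (n : nat) a b delta
    (s0 := sigma0 delta) (sz := sigma_zeta a b) (se := sigma_eta n a b) :
  (2 <= n)%N -> a * b <= - (2 / n%:R) -> a <= - (2 / n%:R) -> 2 / n%:R <= b ->
  0 <= delta <= 1 -> ~ no_critical_value a b delta ->
  [\/ [/\ sigma_zeta_exists a b, sz <= 0, - sz <= delta * (1 - sz) &
          phi a b (- sz) <= 0],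
      [/\ sigma0_exists delta, s0 <= 0, 0 < phi a b (- s0) &
          phi a b (- s0) ^+ n <= (1 - s0) ^+ n.-1]
    | [/\ sigma_eta_exists a b, se <= 0, - se <= delta * (1 - se),
          0 < phi a b (- se) &
          phi a b (- se) ^+ n <=
            expR (- (4 * n%:R)^-1) * (1 - se) ^+ n.-1]].
Proof.
move=> n2 hab ha hb d01 nc.
have n0 : 0 < n%:R :> R by rewrite ltr0n; case: n n2 {hab ha hb s0 se}.
have i0 : 0 < 2 / n%:R :> R by rewrite divr_gt0.
have a0 : a < 0 by lra.
have b0 : 0 < b by lra.
have C0 : 1 + n%:R * (a * b) < 0.
  have : n%:R * (a * b) <= n%:R * - (2 / n%:R) by rewrite ler_pM2l.
  have -> : n%:R * - (2 / n%:R) = - 2 :> R by field; rewrite gt_eqF.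
  by lra.
have [/andP[d0 d1]] := (d01, d01); move=> _.
(* Three cases: [phi] has a positive root, [phi] is the constant 1, or [phi] is positive for all
   [x >= 0]. *)
have [/and3P[a1 b1 ab1]|Nzeta] := boolP [&& a <= -1, 1 <= b & (a, b) != (-1, 1)].
  have ez : sigma_zeta_exists a b.
    split=> // -[aE bE]; move: ab1; by rewrite aE bE eqxx.
  have [x0 phix hx] := sigma_zeta_root ez.
  rewrite -/sz in x0 phix hx.
  have [feas|infeas] := leP (- sz) (delta * (1 - sz)).
    by apply: Or31; split=> //; rewrite ?phix//; lra.
  have [dlt xp0 xlt] := sigma0_bound d01 (ltW x0) infeas.
  rewrite -/s0 in xp0 xlt.
  have /andP[p0 p1] := hx (- s0) (introT andP (conj xp0 xlt)).
  apply: Or32; split=> //; first by rewrite /sigma0_exists lt_eqF.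
    by rewrite -oppr_ge0.
  apply: (@le_trans _ _ 1); first by rewrite exprn_ile1// ltW.
  by rewrite exprn_ege1// lerDl.
have [/eqP[aE bE]|ab1] := boolP ((a, b) == (-1, 1)).
  have dN1 : delta != 1 by apply/eqP => dE; apply: nc.
  have d2 : 0 < 1 - delta by rewrite subr_gt0 lt_neqAle dN1.
  have xp0 : 0 <= - s0 by rewrite opprK divr_ge0// ltW.
  have phi1 : phi a b (- s0) = 1 by rewrite /phi aE bE; ring.
  apply: Or32; split=> //; first by rewrite -oppr_ge0.
    by rewrite phi1.
  by rewrite phi1 expr1n exprn_ege1// lerDl.
have ab : (a > -1) || (b < 1).
  move: Nzeta; rewrite ab1 andbT negb_and -!ltNge.
  by [].
have php x : 0 <= x -> 0 < phi a b x by move=> ?; exact: phi_gt0.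
have heta : a + b = 0 -> 0 < 1 + a * b.
  move=> abE; have bE : b = - a by lra.
  have h : a > -1 by case/orP: ab => //; rewrite bE; lra.
  have -> : 1 + a * b = (1 + a) * (1 - a) by rewrite bE; ring.
  by rewrite mulr_gt0//; lra.
have [x0 Nx] := sigma_eta_root C0 heta.
rewrite -/se in x0 Nx.
have [feas|infeas] := leP (- se) (delta * (1 - se)).
  apply: Or33; split=> //; first by move=> /heta h; rewrite gt_eqF.
  - by rewrite -oppr_ge0 ltW.
  - exact/php/ltW.
  set x := 4 / ((n%:R + 4) * (n%:R * - (a * b))).
  have [xp hx] := step_decrease n2 hab ha hb.
  rewrite -/x in xp hx.
  have x1 : 0 < 1 + x by lra.
  have := phi_ratio_le (ltnW n2) (php _ (ltW x0)) (ltW (php _ (ltW xp)))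
    (ltW x0) (ltW xp).
  rewrite Nx mul0r lexx => /(_ isT) hr.
  have xn : 0 < (1 + x) ^+ n.-1 by rewrite exprn_gt0.
  rewrite -(ler_pM2r xn); apply: (le_trans hr).
  rewrite mulrAC ler_wpM2r//; first by rewrite exprn_ge0//; lra.
  (* The comparison ratio is [f^n (1 + x)] with [f = phi / (1 + x)]. Applying [1 + t <= exp t] to
     both factors bounds it by the exponential of the quantity estimated in [step_decrease]. *)
  have e1 : phi a b x / (1 + x) <= expR (phi a b x / (1 + x) - 1).
    by have := expR_ge1Dx (phi a b x / (1 + x) - 1); lra.
  have px0 : 0 <= phi a b x / (1 + x) by rewrite divr_ge0 ?ltW// php// ltW.
  have e2 : (phi a b x / (1 + x)) ^+ n <= expR (n%:R * (phi a b x / (1 + x) - 1)).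
    by rewrite expRM_natl lerXn2r// nnegrE expR_ge0.
  have e3 : (phi a b x / (1 + x)) ^+ n * (1 + x) <= expR (- (4 * n%:R)^-1).
    apply: (le_trans (ler_pM (exprn_ge0 _ px0) (ltW x1) e2 (expR_ge1Dx x))).
    by rewrite -expRD ler_expR.
  apply: le_trans (ler_wpM2r (ltW xn) e3).
  rewrite -mulrA -exprS prednK; last exact: ltnW.
  by rewrite -exprMn divfK// gt_eqF.
have [dlt xp0 xlt] := sigma0_bound d01 (ltW x0) infeas.
rewrite -/s0 in xp0 xlt.
apply: Or32; split=> //; first by rewrite /sigma0_exists lt_eqF.
- by rewrite -oppr_ge0.
- exact: php.
(* The derivative is still nonpositive at [- s0], so the tangent comparison applies with second
   point 0, where the ratio is 1. *)
have N0 : dphi n a b (- s0) <= 0.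
  by apply: (dphi_le0 (ltW C0) (x := - se)); rewrite ?Nx// xp0 ltW.
have phi0 : phi a b 0 = 1 by rewrite /phi; ring.
have := @phi_ratio_le _ n a b (- s0) 0 (ltnW n2) (php _ xp0).
rewrite phi0 addr0 !expr1n mulr1 mul1r; apply => //.
by rewrite sub0r mulr_le0// oppr_le0.
Qed.

End CriticalCases.

(** * Affine substitution in the Lebesgue integral *)

Section AffineSubstitution.
Context {R : realType}.
Local Open Scope ereal_scope.
Local Notation mu := (@lebesgue_measure R).

(** The image of Lebesgue measure under [t |-> c + k t], scaled by [k], gives half-open intervals
    their length, hence is Lebesgue measure by uniqueness. *)
Lemma ge0_integral_affine (g : R -> \bar R) (c k : R) : (0 < k)%R ->
  measurable_fun setT g -> (forall x, 0 <= g x) ->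
  \int[mu]_x g x = k%:E * \int[mu]_t g (c + k * t)%R.
Proof.
move=> k0 mg g0.
pose F : measurableTypeR R -> measurableTypeR R := fun t : R => (c + k * t)%R.
have mF : measurable_fun setT F.
  by apply: measurable_funD => //; exact: measurable_funM.
pose nu := measure_function_pushforward__canonical__measure_function_Measure mu mF.
pose kn := NngNum (ltW k0).
rewrite (eq_measure_integral (mscale kn nu)).
  by rewrite ge0_integral_mscale// ge0_integral_pushforward.
move=> X mX _; apply: (lebesgue_measure_unique (mu := mscale kn nu)) => //.
move=> _ [[a b]] _ <-.
transitivity (k%:E * mu (F @^-1` `]a, b])); last by [].
have -> : F @^-1` `]a, b] = `]((a - c) / k)%R, ((b - c) / k)%R]%classic.
  apply/seteqP; split => t /=; rewrite !in_itv /= /F ltr_pdivrMr// ler_pdivlMr//;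
    by rewrite ltrBlDl lerBrDl (mulrC t).
rewrite !lebesgue_measure_itv/= !lte_fin ltr_pM2r ?invr_gt0// ltrD2r.
case: ifPn => _; last by rewrite mule0.
by rewrite -!EFinB -EFinM -mulrBl mulrC divfK ?gt_eqF// opprB addrA subrK.
Qed.

End AffineSubstitution.

(** * Integrating the slices of a ball *)

Section BallVolume.
Context {R : realType}.
Local Open Scope ereal_scope.
Local Notation mu := (@lebesgue_measure R).

(* Volume of an n-dimensional ball of squared radius [f], up to the constant of
   the unit ball; a ball of negative squared radius is empty. *)
Definition ball_factor (n : nat) (f : R) : R :=
  if (0 <= f)%R then Num.sqrt (f ^+ n) else 0%R.

(** The integral of [(1 - t^2)^(n/2)] over [[-1, 1]], the ratio of the unit ball volumes in
    dimensions [n + 1] and [n]. *)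
Definition slice_factor (n : nat) : \bar R :=
  \int[mu]_t (ball_factor n (1 - t ^+ 2))%:E.

Fixpoint unit_ball_vol (n : nat) : \bar R :=
  if n is n'.+1 then slice_factor n' * unit_ball_vol n' else 1.

Lemma ball_factor_ge0 n f : (0 <= ball_factor n f)%R.
Proof. by rewrite /ball_factor; case: ifP => // _; exact: sqrtr_ge0. Qed.

Lemma unit_ball_vol_ge0 n : 0 <= unit_ball_vol n.
Proof.
elim: n => //= n IH; rewrite mule_ge0// integral_ge0// => t _.
by rewrite lee_fin ball_factor_ge0.
Qed.

Lemma ball_factorM n f u : (0 < f)%R ->
  ball_factor n (f * u) = (Num.sqrt (f ^+ n) * ball_factor n u)%R.
Proof.
move=> f0; rewrite /ball_factor pmulr_rge0//.
case: ifP => [u0|_]; last by rewrite mulr0.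
by rewrite exprMn sqrtrM// exprn_ge0// ltW.
Qed.

Lemma measurable_ball_factor n : measurable_fun setT (ball_factor n).
Proof.
apply: measurable_fun_ifT.
- exact: measurable_fun_ler.
- have msqrt : measurable_fun setT (@Num.sqrt R).
    by apply: continuous_measurable_fun; exact: sqrt_continuous.
  by apply: (measurableT_comp msqrt); exact: exprn_measurable.
- exact: measurable_cst.
Qed.

Lemma measurable_ball_factor_quad n (f s c : R) :
  measurable_fun setT (fun x : R => (ball_factor n (f - s * (x - c) ^+ 2))%:E).
Proof.
apply/measurable_EFinP; apply: measurableT_comp; first exact: measurable_ball_factor.
apply: measurable_funB => //; apply: measurable_funM => //.
by apply: measurable_funX; exact: measurable_funB.
Qed.

Lemma integral_ball_factor n (f s c : R) : (0 < s)%R ->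
  \int[mu]_x (ball_factor n (f - s * (x - c) ^+ 2))%:E =
  (ball_factor n.+1 f / Num.sqrt s)%:E * slice_factor n.
Proof.
move=> s0; have [f0|f0|f0] := ltgtP f 0%R.
- rewrite {2}/ball_factor leNgt f0/= mul0r mul0e integral0_eq// => x _.
  rewrite /ball_factor ifF//; apply/negbTE; rewrite -ltNge.
  have h : (0 <= s * (x - c) ^+ 2)%R by rewrite mulr_ge0 ?sqr_ge0// ltW.
  by rewrite subr_lt0; lra.
(* The substitution [x = c + k t] turns the integrand into a multiple of the one for the unit
   ball. *)
- pose k := Num.sqrt (f / s).
  have k0 : (0 < k)%R by rewrite sqrtr_gt0 divr_gt0.
  rewrite (@ge0_integral_affine _ _ c k)//; last 2 first.
  - exact: measurable_ball_factor_quad.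
  - by move=> x; rewrite lee_fin ball_factor_ge0.
  have e t : (ball_factor n (f - s * (c + k * t - c) ^+ 2))%:E =
     (Num.sqrt (f ^+ n))%:E * (ball_factor n (1 - t ^+ 2))%:E.
    rewrite -EFinM -ball_factorM//; congr (ball_factor _ _)%:E.
    have k2 : (k ^+ 2 = f / s)%R by rewrite sqr_sqrtr// divr_ge0// ltW.
    have -> : (s * (c + k * t - c) ^+ 2 = s * k ^+ 2 * t ^+ 2)%R by ring.
    by rewrite k2; field; rewrite gt_eqF.
  under eq_integral do rewrite e.
  rewrite ge0_integralZl//; last 2 first.
  - have := measurable_ball_factor_quad n 1 1 0.
    apply: eq_measurable_fun => t _ /=.
    by rewrite mul1r subr0.
  - by move=> t _; rewrite lee_fin ball_factor_ge0.
  rewrite muleA -EFinM; congr (_%:E * _).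
  rewrite /ball_factor ltW// exprS sqrtrM ?ltW// /k sqrtrM ?ltW// sqrtrV ?ltW//.
  by rewrite mulrAC.
(* The integrand vanishes off the null set [{c}]; at [c] it equals 1 when [n = 0]. *)
- rewrite f0 {2}/ball_factor lexx expr0n/= sqrtr0 mul0r mul0e.
  rewrite -(@integral_setD1 _ _ c)//.
  + apply: integral0_eq => x [_ /= /eqP xc].
    rewrite /ball_factor ifF//; apply/negbTE; rewrite -ltNge sub0r oppr_lt0.
    by rewrite mulr_gt0// lt_def sqr_ge0 sqrf_eq0 subr_eq0 xc.
  + exact: measurableD.
  + by apply: measurable_funTS; exact: measurable_ball_factor_quad.
Qed.

End BallVolume.

(** * Positive definite forms and volumes of ellipsoids *)

Section QuadraticForms.
Context {R : realType}.

Definition quad_ball (n : nat) (M : 'M[R]_n) (c : 'cV[R]_n) (f : R) : set 'cV[R]_n :=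
  [set y | ((y - c)^T *m M *m (y - c)) 0 0 <= f].

Lemma posdef_unitmx (n : nat) (M : 'M[R]_n) : posdefmx M -> M \in unitmx.
Proof.
move=> [_ pM]; rewrite -row_free_unit -kermx_eq0.
apply/eqP/row_matrixP => i; rewrite row0; apply/eqP/negPn/negP => v0.
have := pM (row i (kermx M))^T; rewrite trmx_eq0 trmxK => /(_ v0).
by rewrite -row_mul mulmx_ker row0 mul0mx mxE ltxx.
Qed.

Lemma quad_form_congr (n : nat) (U D : 'M[R]_n) (x : 'cV[R]_n) :
  x^T *m (U^T *m D *m U) *m x = (U *m x)^T *m D *m (U *m x).
Proof. by rewrite trmx_mul !mulmxA. Qed.

(** Fixes the first coordinate and translates each slice on which that coordinate is constant. *)
Definition shear (n : nat) (W : 'cV[R]_n) : 'M[R]_(1 + n) := block_mx 1%:M 0 W 1%:M.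

(* Completing the square in all coordinates but the first. *)
Lemma posdef_schur (n : nat) (M : 'M[R]_(1 + n)) : posdefmx M ->
  exists s (W : 'cV[R]_n) (N : 'M[R]_n), [/\ 0 < s, posdefmx N &
    M = (shear W)^T *m block_mx s%:M 0 0 N *m shear W].
Proof.
move=> pM; have [symM posM] := pM.
pose N := drsubmx M; pose B := dlsubmx M.
have symN : N^T = N by rewrite /N trmx_drsub symM.
have symB : ursubmx M = B^T by rewrite /B -{1}symM trmx_dlsub.
have pN : posdefmx N.
  split=> // x x0; have := posM (col_mx 0 x).
  rewrite -[M]submxK tr_col_mx mul_row_block mul_row_col !trmx0 !mul0mx !mulmx0 !add0r.
  by apply; rewrite col_mx_eq0 negb_and x0 orbT.
have uN := posdef_unitmx pN.
pose W := invmx N *m B.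
pose s := (ulsubmx M - W^T *m N *m W) 0 0.
have ME : M = (shear W)^T *m block_mx s%:M 0 0 N *m shear W.
  rewrite /shear tr_block_mx !trmx1 !trmx0 !mulmx_block !mulmx0 !mul0mx !mulmx1 !mul1mx.
  rewrite !addr0 !add0r.
  have -> : s%:M = ulsubmx M - W^T *m N *m W by rewrite [RHS]mx11_scalar.
  have NW : N *m W = B by rewrite /W mulmxA mulmxV// mul1mx.
  rewrite subrK NW.
  have -> : W^T *m N = B^T by rewrite -{1}symN -trmx_mul NW.
  by rewrite -symB submxK.
exists s, W, N; split=> //.
(* The shear sends this vector to the first basis vector, so the form takes the value [s] on it. *)
have := posM (col_mx 1%:M (- W)).
have z0 : col_mx 1%:M (- W) != 0 :> 'cV[R]_(1 + n).
  by rewrite col_mx_eq0 negb_and oner_neq0.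
move=> /(_ z0).
rewrite [M]ME quad_form_congr.
rewrite /shear !mul_block_col.
rewrite !mul1mx !mulmx1 !mul0mx addr0 subrr tr_col_mx mul_row_block mul_row_col.
by rewrite !trmx0 trmx1 !mul0mx !mulmx0 !addr0 mul1mx mulmx1 mxE.
Qed.

Lemma det_shear (n : nat) (W : 'cV[R]_n) : \det (shear W) = 1.
Proof. by rewrite det_lblock !det1 mulr1. Qed.

Lemma det_schur (n : nat) (s : R) (W : 'cV[R]_n) (N : 'M[R]_n) :
  \det ((shear W)^T *m block_mx s%:M 0 0 N *m shear W) = s * \det N.
Proof.
by rewrite !det_mulmx det_tr det_shear mul1r mulr1 det_ublock det_scalar1.
Qed.

Lemma posdef_det_gt0 (n : nat) (M : 'M[R]_n) : posdefmx M -> 0 < \det M.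
Proof.
elim: n M => [|n IH] M pM; first by rewrite det_mx00.
have [s [W [N [s0 pN ->]]]] := posdef_schur (n := n) pM.
by rewrite (det_schur s W N) mulr_gt0// IH.
Qed.

Local Open Scope ereal_scope.
Local Notation mu := (@lebesgue_measure R).

(** The product measure unfolds to the integral of the measures of sections; what remains is to
    match a tuple with head [x] with a block column. *)
Lemma volS (n : nat) (S : set 'cV[R]_n.+1) :
  vol S = \int[mu]_x vol [set y : 'cV[R]_n | S (col_mx (const_mx x : 'cV[R]_1) y)].
Proof.
rewrite /vol /= /product_measure1; apply: eq_integral => x _ /=.
have e (t : n.-tuple R) :
    (\col_i tnth [tuple of x :: t] i : 'cV[R]_(1 + n))%R =
    col_mx (const_mx x : 'cV[R]_1) (\col_i tnth t i).
  apply/colP => i; case: (@split_ordP 1 n i) => k ->; rewrite mxE.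
    rewrite col_mxEu ord1 mxE (_ : lshift n ord0 = ord0)//; exact: val_inj.
  rewrite col_mxEd mxE -(tnthS x t); congr (tnth _ _); exact: val_inj.
congr lebesgue_tuple; apply/seteqP; split=> t /=; rewrite /xsection /= inE /= e//.
Qed.

Lemma quad_ball_slice (n : nat) (s f x : R) (W : 'cV[R]_n) (N : 'M[R]_n)
    (c : 'cV[R]_(1 + n)) :
  [set y | quad_ball ((shear W)^T *m block_mx s%:M 0 0 N *m shear W) c f
             (col_mx (const_mx x : 'cV[R]_1) y)] =
  quad_ball N (dsubmx c - (x - c 0 0) *: W)%R (f - s * (x - c 0 0) ^+ 2)%R.
Proof.
apply/seteqP; suff h (y : 'cV[R]_n) :
  quad_ball ((shear W)^T *m block_mx s%:M 0 0 N *m shear W) c f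
             (col_mx (const_mx x : 'cV[R]_1) y) =
  quad_ball N (dsubmx c - (x - c 0 0) *: W)%R (f - s * (x - c 0 0) ^+ 2)%R y.
  by split=> y /=; rewrite h.
rewrite /quad_ball /=.
set z := (y - _)%R.
have e : (shear W *m (col_mx (const_mx x) y - c) = col_mx (x - c 0 0)%:M z)%R.
  rewrite -{1}[c]vsubmxK opp_col_mx add_col_mx /shear mul_block_col !mul1mx mul0mx addr0.
  have -> : (const_mx x - usubmx c = (x - c 0 0)%:M)%R.
    apply/colP => i; rewrite !ord1 !mxE eqxx mulr1n; congr (_ - c _ _)%R.
    exact: val_inj.
  by rewrite mul_mx_scalar /z opprB addrCA addrA.
rewrite quad_form_congr e.
rewrite tr_col_mx mul_row_block mul_row_col !mulmx0 addr0 add0r mxE.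
rewrite tr_scalar_mx -!scalar_mxM mxE eqxx mulr1n.
rewrite lerBrDl (_ : (x - c 0 0) * s * (x - c 0 0) = s * (x - c 0 0) ^+ 2)%R//.
by ring.
Qed.

(** Induction on the dimension by slicing along the first coordinate. Every real [f] is allowed,
    since slices far from the center have negative squared radius. *)
Lemma vol_quad_ball (n : nat) (M : 'M[R]_n) c f : posdefmx M ->
  vol (quad_ball M c f) =
  (ball_factor n f / Num.sqrt (\det M))%:E * unit_ball_vol n.
Proof.
elim: n M c f => [|n IH] M c f pM.
  (* In dimension 0 the only point belongs to the set exactly when [0 <= f]. *)
  rewrite /= mule1 det_mx00 sqrtr1 divr1 /vol /=.
  rewrite /dirac indicE /ball_factor expr0 sqrtr1.
  rewrite (_ : _ \in _ = (0 <= f)%R); first by case: ifP.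
  by apply/idP/idP; rewrite inE /quad_ball /= [(_ - c)%R]flatmx0 mulmx0 mxE.
have [s [W [N [s0 pN ->]]]] := posdef_schur (n := n) pM.
rewrite volS (det_schur s W N).
under eq_integral do rewrite (quad_ball_slice s f _ W N c) IH//.
have dN : (0 < \det N)%R := posdef_det_gt0 pN.
have -> : (fun x : measurableTypeR R =>
    (ball_factor n (f - s * (x - c 0 0) ^+ 2) / Num.sqrt (\det N))%:E *
      unit_ball_vol n) =
  (fun x => (Num.sqrt (\det N))^-1%:E * unit_ball_vol n *
      (ball_factor n (f - s * (x - c 0 0) ^+ 2))%:E).
  by apply/funext => x; rewrite EFinM (muleC (ball_factor _ _)%:E) muleAC.
rewrite ge0_integralZl//; last 3 first.
- exact: measurable_ball_factor_quad.
- by move=> x _; rewrite lee_fin ball_factor_ge0.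
- by rewrite mule_ge0 ?unit_ball_vol_ge0// lee_fin invr_ge0 sqrtr_ge0.
rewrite integral_ball_factor// muleACA -EFinM (muleC (unit_ball_vol n)).
congr (_%:E * _); rewrite sqrtrM ?ltW// invfM; ring.
Qed.

End QuadraticForms.

(** * Rank-one updates of positive definite matrices *)

Section RankOneUpdate.
Context {R : realType} {n m : nat}.
Implicit Types (A : 'M[R]_(n, m)) (M : 'M[R]_n) (a x z : 'cV[R]_n).

(** One bordered matrix has two block triangular factorizations; comparing their determinants gives
    the identity. *)
Lemma det_rank_one (u : 'cV[R]_n) (v : 'rV[R]_n) :
  \det (1%:M + u *m v) = 1 + (v *m u) 0 0.
Proof.
pose L := block_mx 1%:M 0 u 1%:M : 'M[R]_(1 + n).
have dL : \det L = 1 by rewrite det_lblock !det1 mulr1.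
have e1 : block_mx 1%:M (- v) u 1%:M = L *m block_mx 1%:M (- v) 0 (1%:M + u *m v).
  by rewrite mulmx_block !mul1mx !mulmx1 !mul0mx !addr0 mulmxN addrCA addNr addr0.
have e2 : block_mx 1%:M (- v) u 1%:M = block_mx (1%:M + v *m u) (- v) 0 1%:M *m L.
  by rewrite mulmx_block !mul1mx !mulmx1 !mul0mx mulmx0 !add0r mulNmx addrK.
have : \det (L *m block_mx 1%:M (- v) 0 (1%:M + u *m v)) =
       \det (block_mx (1%:M + v *m u) (- v) 0 1%:M *m L) by rewrite -e1 e2.
rewrite !det_mulmx !det_ublock !det1 dL !mul1r !mulr1 => ->.
by rewrite [_ + _]mx11_scalar det_scalar1 !mxE eqxx.
Qed.

Lemma det_update M a t : M \in unitmx ->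
  \det (M + t *: (a *m a^T)) = \det M * (1 + t * (a^T *m invmx M *m a) 0 0).
Proof.
move=> uM.
have -> : M + t *: (a *m a^T) = M *m (1%:M + (t *: (invmx M *m a)) *m a^T).
  by rewrite mulmxDr mulmx1 -scalemxAl -scalemxAr !mulmxA mulmxV// mul1mx.
by rewrite det_mulmx det_rank_one -scalemxAr mxE mulmxA.
Qed.

Lemma dot_sym (x y : 'cV[R]_n) : (x^T *m y) 0 0 = (y^T *m x) 0 0.
Proof. by rewrite -[in LHS](trmxK y) -trmx_mul mxE. Qed.

Lemma quad_rank_one a x : (x^T *m (a *m a^T) *m x) 0 0 = (a^T *m x) 0 0 ^+ 2.
Proof. by rewrite mulmxA -mulmxA mxE big_ord1 dot_sym expr2. Qed.

Lemma posdef_inv_quad_gt0 M a : posdefmx M -> a != 0 ->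
  0 < (a^T *m invmx M *m a) 0 0.
Proof.
move=> pM a0; have uM := posdef_unitmx pM; have [symM posM] := pM.
have w0 : invmx M *m a != 0.
  apply: contraNneq a0 => w0.
  by rewrite -[a]mul1mx -(mulmxV uM) -mulmxA w0 mulmx0.
have := posM _ w0.
by rewrite trmx_mul trmx_inv symM -!mulmxA mulKVmx// mulmxA.
Qed.

Lemma quad_formD M x y k : M^T = M ->
  ((x + k *: y)^T *m M *m (x + k *: y)) 0 0 =
  (x^T *m M *m x) 0 0 + 2 * k * (x^T *m M *m y) 0 0 + k ^+ 2 * (y^T *m M *m y) 0 0.
Proof.
move=> symM.
have yx : (y^T *m M *m x) 0 0 = (x^T *m M *m y) 0 0.
  by rewrite -mulmxA dot_sym trmx_mul symM.
have -> : (x + k *: y)^T = x^T + k *: y^T by rewrite linearD linearZ.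
rewrite !mulmxDl !mulmxDr -!scalemxAl -!scalemxAr scalerA.
have addE (P Q : 'M[R]_1) : (P + Q) 0 0 = P 0 0 + Q 0 0 by rewrite mxE.
have scaleE c (P : 'M[R]_1) : (c *: P) 0 0 = c * P 0 0 by rewrite mxE.
rewrite !addE !scaleE yx; ring.
Qed.

(** The form is nonnegative at [x - k M^-1 a]; the chosen [k] minimizes it. *)
Lemma cauchy_schwarz_posdef M a x : posdefmx M -> a != 0 ->
  (a^T *m x) 0 0 ^+ 2 <=
  (a^T *m invmx M *m a) 0 0 * (x^T *m M *m x) 0 0.
Proof.
move=> pM a0; have uM := posdef_unitmx pM; have [symM posM] := pM.
have g0 := posdef_inv_quad_gt0 pM a0.
set g := (a^T *m invmx M *m a) 0 0 in g0 *.
pose k := (a^T *m x) 0 0 / g.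
have Mw : M *m (invmx M *m a) = a by rewrite mulmxA mulmxV// mul1mx.
have q0 : 0 <= ((x + - k *: (invmx M *m a))^T *m M *m (x + - k *: (invmx M *m a))) 0 0.
  have [->|y0] := eqVneq (x + - k *: (invmx M *m a)) 0; last exact/ltW/posM.
  by rewrite mulmx0 mxE.
have e1 : (x^T *m M *m (invmx M *m a)) 0 0 = (a^T *m x) 0 0.
  by rewrite -mulmxA Mw dot_sym.
have e2 : ((invmx M *m a)^T *m M *m (invmx M *m a)) 0 0 = g.
  by rewrite -mulmxA Mw dot_sym mulmxA.
move: q0; rewrite quad_formD// e1 e2 /k.
have -> : (a^T *m x) 0 0 ^+ 2 = g * ((a^T *m x) 0 0 ^+ 2 / g).
  by rewrite mulrC divfK ?gt_eqF.
move=> h; rewrite ler_pM2l//; move: h.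
set c := (a^T *m x) 0 0; set q := (x^T *m M *m x) 0 0.
have -> : q + 2 * - (c / g) * c + (- (c / g)) ^+ 2 * g = q - c ^+ 2 / g.
  by field; rewrite gt_eqF.
by rewrite subr_ge0.
Qed.

(** For [t < 0], Cauchy-Schwarz bounds the loss and leaves at least [q (1 + t g)], where [q] is the
    old value of the form and [g = a^T M^-1 a]. *)
Lemma posdef_update M a t : posdefmx M -> a != 0 ->
  0 < 1 + t * (a^T *m invmx M *m a) 0 0 -> posdefmx (M + t *: (a *m a^T)).
Proof.
move=> pM a0 t1; have [symM posM] := pM; split.
  by rewrite linearD linearZ /= symM trmx_mul trmxK.
move=> x x0; have -> : (x^T *m (M + t *: (a *m a^T)) *m x) 0 0 =
    (x^T *m M *m x) 0 0 + t * (a^T *m x) 0 0 ^+ 2.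
  rewrite -quad_rank_one mulmxDr mulmxDl -scalemxAr -scalemxAl mxE.
  by congr (_ + _); rewrite mxE.
have cs := cauchy_schwarz_posdef x pM a0.
have qx := posM _ x0.
have [t0|t0] := leP 0 t; first by rewrite ltr_pwDl// mulr_ge0// sqr_ge0.
set q := (x^T *m M *m x) 0 0 in cs qx *; set g := (a^T *m invmx M *m a) 0 0 in cs t1.
have h1 : t * (g * q) <= t * (a^T *m x) 0 0 ^+ 2 by rewrite ler_nM2l.
have h2 : 0 < q * (1 + t * g) by rewrite mulr_gt0.
by lra.
Qed.


End RankOneUpdate.

(** * Changing a single weight *)

Section DiagonalUpdate.
Context {R : realType} {n m : nat}.
Implicit Types (A : 'M[R]_(n, m)) (u l d r : 'cV[R]_m) (j : 'I_m).

Lemma Diag_update d t j :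
  Diag (d + t *: delta_mx j 0) =
  Diag d + t *: (delta_mx j (0 : 'I_1) *m delta_mx (0 : 'I_1) j).
Proof.
rewrite mul_delta_mx; apply/matrixP => i k; rewrite /Diag !mxE.
have [<-|ik] := eqVneq i k; first by rewrite !mulr1n andbT andbb.
rewrite !mulr0n (_ : _ && _ = false) ?mulr0 ?addr0//.
by apply/negP => /andP[/eqP ij /eqP kj]; rewrite ij kj eqxx in ik.
Qed.

Lemma ADAt_update A d t j :
  ADAt A (d + t *: delta_mx j 0) = ADAt A d + t *: (col j A *m (col j A)^T).
Proof.
rewrite /ADAt Diag_update mulmxDr mulmxDl -scalemxAr -scalemxAl.
congr (_ + _ *: _).
by rewrite mulmxA -colE -mulmxA -rowE tr_col.
Qed.

Lemma ADr_update A d r t j :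
  A *m Diag (d + t *: delta_mx j 0) *m r =
  A *m Diag d *m r + (t * r j 0) *: col j A.
Proof.
rewrite Diag_update mulmxDr mulmxDl -scalemxAr -scalemxAl -scalerA.
congr (_ + _ *: _).
rewrite mulmxA -colE -mulmxA -rowE.
by rewrite [row j r]mx11_scalar mul_mx_scalar mxE.
Qed.

Lemma quad_Diag_update r d t j :
  (r^T *m Diag (d + t *: delta_mx j 0) *m r) 0 0 =
  (r^T *m Diag d *m r) 0 0 + t * r j 0 ^+ 2.
Proof.
rewrite Diag_update mulmxDr mulmxDl -scalemxAr -scalemxAl mxE.
congr (_ + _); rewrite mxE; congr (_ * _).
rewrite mulmxA -colE -mulmxA -rowE -tr_row [row j r]mx11_scalar tr_scalar_mx.
by rewrite -scalar_mxM !mxE eqxx mulr1n expr2.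
Qed.

Lemma ADAt_quad A d (x : 'cV[R]_n) :
  (x^T *m ADAt A d *m x) 0 0 = \sum_i d i 0 * ((col i A)^T *m x) 0 0 ^+ 2.
Proof.
have -> : x^T *m ADAt A d *m x = (A^T *m x)^T *m Diag d *m (A^T *m x).
  by rewrite /ADAt trmx_mul trmxK !mulmxA.
set X := A^T *m x; rewrite mxE; apply: eq_bigr => i _.
have -> : ((col i A)^T *m x) 0 0 = X i 0 by rewrite tr_col -row_mul mxE.
by rewrite mul_mx_diag mxE [X^T _ _]mxE [d^T _ _]mxE mulrAC mulrC expr2.
Qed.

(** At [w = M^-1 a_j], with [M = A D A^T], the form equals [gamma^2], while its [j]th summand alone
    is [d_j gamma^4]. *)
Lemma dj_gamma_sqr_le1 A d j : vec_ge0 d -> posdefmx (ADAt A d) ->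
  col j A != 0 -> d j 0 * gamma A d j ^+ 2 <= 1.
Proof.
move=> d0 pM a0; have g0 := posdef_inv_quad_gt0 pM a0.
have [symM _] := pM; have uM := posdef_unitmx pM.
rewrite /gamma sqr_sqrtr; last exact: ltW.
set g := (_ *m _) 0 0 in g0 *.
rewrite -(ler_pM2r g0) mul1r.
pose w := invmx (ADAt A d) *m col j A.
have wg : (w^T *m ADAt A d *m w) 0 0 = g.
  by rewrite -mulmxA /w [ADAt A d *m _]mulmxA mulmxV// mul1mx dot_sym mulmxA.
rewrite -[leRHS]wg ADAt_quad (bigD1 j)//= -[leLHS]addr0 lerD//.
  by rewrite /w mulmxA -/g expr2 mulrA.
by rewrite sumr_ge0// => i _; rewrite mulr_ge0 ?sqr_ge0.
Qed.

End DiagonalUpdate.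

(** * Determinant and [f] after the update *)

Section StepFormulas.
Context {R : realType} {n m : nat}.
Variables (A : 'M[R]_(n, m)) (u l d : 'cV[R]_m) (j : 'I_m).
Hypotheses (posdef : posdefmx (ADAt A d)) (a_neq0 : col j A != 0).

Lemma gamma_sqr : gamma A d j ^+ 2 =
  ((col j A)^T *m invmx (ADAt A d) *m col j A) 0 0.
Proof. by rewrite sqr_sqrtr// ltW// posdef_inv_quad_gt0. Qed.

Lemma gamma_gt0 : 0 < gamma A d j.
Proof. by rewrite sqrtr_gt0 posdef_inv_quad_gt0. Qed.

Lemma dplus_factor s : s < 1 ->
  1 + s / ((1 - s) * gamma A d j ^+ 2) *
     ((col j A)^T *m invmx (ADAt A d) *m col j A) 0 0 = (1 - s)^-1.
Proof.
move=> s1; rewrite -gamma_sqr; have g0 := gamma_gt0.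
have s0 : 0 < 1 - s by rewrite subr_gt0.
by field; rewrite !gt_eqF.
Qed.

Lemma posdef_dplus s : s < 1 -> posdefmx (ADAt A (dplus A d j s)).
Proof.
move=> s1; rewrite /dplus ADAt_update; apply: posdef_update => //.
by rewrite dplus_factor// invr_gt0 subr_gt0.
Qed.

Lemma det_dplus s : s < 1 ->
  \det (ADAt A (dplus A d j s)) = \det (ADAt A d) / (1 - s).
Proof.
move=> s1; rewrite /dplus ADAt_update det_update ?posdef_unitmx//.
by rewrite dplus_factor.
Qed.

(** Any solution [z] of the normal equations determines [f], so the updated inverse need not be
    written out. *)
Lemma fvalE d' z : posdefmx (ADAt A d') ->
  ADAt A d' *m z = A *m Diag d' *m midpt u l ->
  fval A u d' l = ((A *m Diag d' *m midpt u l)^T *m z) 0 0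
    - ((midpt u l)^T *m Diag d' *m midpt u l) 0 0
    + ((halfwidth u l)^T *m Diag d' *m halfwidth u l) 0 0.
Proof.
move=> pM Mz; have uM := posdef_unitmx pM.
have zE : z = invmx (ADAt A d') *m (A *m Diag d' *m midpt u l).
  by rewrite -Mz mulmxA mulVmx// mul1mx.
rewrite /fval zE; congr (_ - _ + _).
by rewrite !trmx_mul /Diag tr_diag_mx !mulmxA.
Qed.

Lemma centerE : ADAt A d *m Defs.center A u d l = A *m Diag d *m midpt u l.
Proof. by rewrite /Defs.center !mulmxA mulmxV ?mul1mx// posdef_unitmx. Qed.

Lemma fval_dplus s : s < 1 -> fval A u d l = 1 ->
  fval A u (dplus A d j s) l =
  phi (alpha A u d l j) (beta A u d l j) (- s) / (1 - s).
Proof.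
move=> s1 f1; have g0 := gamma_gt0; have uM := posdef_unitmx posdef.
have [symM _] := posdef.
set al := alpha A u d l j; set be := beta A u d l j.
set a := col j A; set z := Defs.center A u d l; set r := midpt u l.
set w := invmx (ADAt A d) *m a.
set g := gamma A d j in g0 *.
set y := (a^T *m z) 0 0.
have uE : u j 0 = y - al * g by rewrite /al /alpha -/g divfK ?gt_eqF// subKr.
have lE : l j 0 = y - be * g by rewrite /be /beta -/g divfK ?gt_eqF// subKr.
have Mw : ADAt A d *m w = a by rewrite /w mulmxA mulmxV// mul1mx.
have Mz : ADAt A d *m z = A *m Diag d *m r by exact: centerE.
have aw : (a^T *m w) 0 0 = g ^+ 2 by rewrite /w mulmxA -gamma_sqr.
have bw : ((A *m Diag d *m r)^T *m w) 0 0 = y.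
  by rewrite -Mz trmx_mul symM -mulmxA Mw dot_sym.
pose t := s / ((1 - s) * g ^+ 2).
have rj : r j 0 = (u j 0 + l j 0) / 2 by rewrite /r /midpt !mxE mulrC.
have vj : halfwidth u l j 0 = (u j 0 - l j 0) / 2 by rewrite /halfwidth !mxE mulrC.
(* The center moves along [w]; [k] solves the scalar equation [kE], which makes [z + k w] satisfy
   the updated normal equations. *)
pose k := - (s * ((al + be) / 2)) / g.
have s0 : 0 < 1 - s by rewrite subr_gt0.
have kE : k + t * (y + k * g ^+ 2) = t * r j 0.
  by rewrite rj uE lE /k /t; field; rewrite !gt_eqF.
have Mz' : ADAt A (dplus A d j s) *m (z + k *: w) =
    A *m Diag (dplus A d j s) *m r.
  have e1 : a *m a^T *m z = y *: a.
    by rewrite -mulmxA [a^T *m z]mx11_scalar mul_mx_scalar.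
  have e2 : a *m a^T *m w = g ^+ 2 *: a.
    by rewrite -mulmxA [a^T *m w]mx11_scalar mul_mx_scalar aw.
  rewrite /dplus -/g -/t ADAt_update ADr_update -/a -Mz mulmxDl !mulmxDr.
  rewrite -!scalemxAr -!scalemxAl Mw e1 e2 -addrA -kE !scalerA -!scalerDl.
  by congr (_ + _); congr (_ *: _); ring.
have := fvalE posdef Mz; rewrite f1 -/r => f1'.
rewrite (fvalE (posdef_dplus s1) Mz').
rewrite /dplus -/g -/t !quad_Diag_update ADr_update.
set q1 := (r^T *m Diag d *m r) 0 0 in f1' *.
set q2 := (_^T *m Diag d *m _) 0 0 in f1' *.
set b := A *m Diag d *m r in bw f1' *.
have -> : ((b + (t * r j 0) *: col j A)^T *m (z + k *: w)) 0 0 =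
   (b^T *m z) 0 0 + k * y + t * r j 0 * y + t * r j 0 * (k * g ^+ 2).
  have -> : (b + (t * r j 0) *: col j A)^T = b^T + (t * r j 0) *: a^T.
    by rewrite linearD linearZ.
  have addE (P Q : 'M[R]_1) : (P + Q) 0 0 = P 0 0 + Q 0 0 by rewrite mxE.
  have scaleE c (P : 'M[R]_1) : (c *: P) 0 0 = c * P 0 0 by rewrite mxE.
  rewrite !mulmxDl !mulmxDr -!scalemxAl -!scalemxAr !addE !scaleE bw aw -/y.
  by rewrite !addrA.
rewrite vj rj uE lE -/r.
have -> : (b^T *m z) 0 0 = 1 + q1 - q2 by rewrite f1' -/r; ring.
by rewrite /k /t /phi; field; rewrite !gt_eqF.
Qed.

End StepFormulas.

(** * Effect of a step on feasibility, [gtilde] and volume *)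

Section StepConsequences.
Context {R : realType} {n m : nat}.
Variables (A : 'M[R]_(n, m)) (u l d : 'cV[R]_m) (j : 'I_m).
Hypotheses (posdef : posdefmx (ADAt A d)) (a_neq0 : col j A != 0).
Hypotheses (d_ge0 : vec_ge0 d) (f_eq1 : fval A u d l = 1).

Lemma dplus_ge0 (s : R) : s <= 0 ->
  - s <= d j 0 * gamma A d j ^+ 2 * (1 - s) -> vec_ge0 (dplus A d j s).
Proof.
move=> s0 feas i; rewrite /dplus !mxE.
have [->|ij] := eqVneq i j; last by rewrite mulr0 addr0.
rewrite eqxx mulr1; have g0 : 0 < gamma A d j ^+ 2 by rewrite exprn_gt0//; exact: gamma_gt0.
have s1 : 0 < 1 - s by lra.
have p0 : 0 < (1 - s) * gamma A d j ^+ 2 by exact: mulr_gt0.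
rewrite -(pmulr_lge0 _ p0) mulrDl divfK ?gt_eqF//; lra.
Qed.

Lemma gtilde_dplus (s : R) : s < 1 ->
  gtilde A u (dplus A d j s) l - gtilde A u d l =
  n%:R * (phi (alpha A u d l j) (beta A u d l j) (- s) / (1 - s) - 1) + ln (1 - s).
Proof.
move=> s1; have s0 : 0 < 1 - s by rewrite subr_gt0.
rewrite /gtilde /pval f_eq1 fval_dplus// det_dplus// ln_div ?posrE ?posdef_det_gt0//.
ring.
Qed.

(** The squared volume is a constant times [f^n / det]. Here [f^n] becomes [phi^n / (1 - s)^n] and
    [det] is divided by [1 - s], which leaves the exponent [n - 1]. *)
Lemma vol_dplus_le (s K : R) : (0 < n)%N -> s < 1 -> 0 <= K ->
  0 < phi (alpha A u d l j) (beta A u d l j) (- s) ->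
  phi (alpha A u d l j) (beta A u d l j) (- s) ^+ n <= K ^+ 2 * (1 - s) ^+ n.-1 ->
  0 < fval A u (dplus A d j s) l /\
  (vol (ellipsoid A u (dplus A d j s) l) <= K%:E * vol (ellipsoid A u d l))%E.
Proof.
move=> n0 s1 K0 phi0 hK; have s0 : 0 < 1 - s by rewrite subr_gt0.
have f0 : 0 < fval A u (dplus A d j s) l by rewrite fval_dplus// divr_gt0.
split=> //.
have volE d' : posdefmx (ADAt A d') -> vol (ellipsoid A u d' l) =
    ((ball_factor n (fval A u d' l) / Num.sqrt (\det (ADAt A d')))%:E *
     unit_ball_vol n)%E by move=> pM; exact: vol_quad_ball.
rewrite !volE//; last exact: posdef_dplus.
rewrite muleA -EFinM lee_wpmul2r ?unit_ball_vol_ge0// lee_fin.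
rewrite f_eq1 det_dplus//; have D0 := posdef_det_gt0 posdef.
rewrite /ball_factor ler01 expr1n sqrtr1 (ltW f0) div1r.
rewrite ler_pdivrMr ?sqrtr_gt0 ?divr_gt0// sqrtrM ?(ltW D0)//.
rewrite -mulrA mulKf ?gt_eqF ?sqrtr_gt0//.
rewrite -[K]ger0_norm// -sqrtr_sqr -sqrtrM ?sqr_ge0// ler_wsqrtr//.
rewrite fval_dplus// expr_div_n ler_pdivrMr ?exprn_gt0//.
have -> : (1 - s) ^+ n = (1 - s) * (1 - s) ^+ n.-1 by rewrite -exprS prednK.
by rewrite mulrA divfK ?gt_eqF.
Qed.

End StepConsequences.

(** * Descent of [gtilde] and the three alternatives *)

Theorem theorem3 (R : realType) (n m : nat) (A : 'M[R]_(n, m))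
    (u l d : 'cV[R]_m) (Lambda : 'M[R]_m) (j : 'I_m)
    (n_ge2 : (2 <= n)%N)
    (rankA : \rank A = n)
    (colA_neq0 : forall i, col i A != 0)
    (ltlu : forall i, l i 0 < u i 0)
    (Lambda_ge0 : forall i k, 0 <= Lambda i k)
    (ALambda : A *m Lambda = - A)
    (lLambda : l = - (Lambda^T *m u))
    (d_ge0 : vec_ge0 d)
    (posdef : posdefmx (ADAt A d))
    (f_eq1 : fval A u d l = 1) :
  let al := alpha A u d l j in
  let be := beta A u d l j in
  let delta := d j 0 * gamma A d j ^+ 2 in
  let dp := dplus A d j in
  let s0 := sigma0 delta in
  let sz := sigma_zeta al be in
  let se := sigma_eta n al be in
  al * be <= - (2 / n%:R) ->
  Num.max al (- be) <= - (2 / n%:R) ->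
  (exists2 sh : R, sh < 0 &
     gtilde A u (dp sh) l <= gtilde A u d l - (4 * n%:R)^-1)
  /\
  (~ no_critical_value al be delta ->
   [\/ [/\ sigma_zeta_exists al be, sz < 1,
           vec_ge0 (dp sz) & fval A u (dp sz) l <= 0],
       [/\ sigma0_exists delta, s0 < 1, 0 < fval A u (dp s0) l &
           (vol (ellipsoid A u (dp s0) l) <= vol (ellipsoid A u d l))%E]
     | [/\ sigma_eta_exists al be, se < 1, vec_ge0 (dp se),
           0 < fval A u (dp se) l &
           (vol (ellipsoid A u (dp se) l)
            <= (expR (- (8 * n%:R)^-1))%:E * vol (ellipsoid A u d l))%E]]).
Proof.
move=> al be delta dp s0 sz se hab; rewrite ge_max => /andP[ha hb].
have n0 : (0 < n)%N by exact: ltnW.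
have nR : 0 < n%:R :> R by rewrite ltr0n.
have hb' : 2 / n%:R <= be by rewrite -lerN2.
have d01 : 0 <= delta <= 1.
  by rewrite mulr_ge0 ?sqr_ge0//= dj_gamma_sqr_le1.
split.
  have [x0 hx] := step_decrease n_ge2 hab ha hb'.
  set x := 4 / _ in x0 hx; exists (- x); first by rewrite oppr_lt0.
  rewrite -lerBlDl gtilde_dplus//; last by lra.
  (* [ln (1 + x) <= x] replaces the logarithm by the linear term of the scalar estimate. *)
  rewrite !opprK; apply: le_trans hx; rewrite lerD2l le_ln1Dx//; lra.
have vol_le1 (s : R) : s <= 0 -> 0 < phi al be (- s) ->
    phi al be (- s) ^+ n <= (1 - s) ^+ n.-1 ->
    0 < fval A u (dp s) l /\
    (vol (ellipsoid A u (dp s) l) <= vol (ellipsoid A u d l))%E.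
  move=> sle0 phi0 hphi; rewrite -[X in (_ <= X)%E]mul1e.
  by apply: vol_dplus_le => //; [lra | rewrite expr1n mul1r].
move=> /(critical_cases n_ge2 hab ha hb' d01); case.
- move=> [ez z0 feas phiz]; have z1 : sz < 1 by exact: le_lt_trans z0 ltr01.
  apply: Or31; split=> //; first exact: dplus_ge0.
  by rewrite fval_dplus// pmulr_lle0// invr_gt0 subr_gt0.
- move=> [e0 le0 phi0 hphi]; have [f0 hv] := vol_le1 _ le0 phi0 hphi.
  by apply: Or32; split=> //; exact: le_lt_trans le0 ltr01.
- move=> [ee e0 feas phi0 hphi].
  have se1 : se < 1 by exact: le_lt_trans e0 ltr01.
  (* The scalar estimate concerns squared volumes, hence [1/(4n)] there and [1/(8n)] here. *)
  have hphi' : phi al be (- se) ^+ n <=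
      expR (- (8 * n%:R)^-1) ^+ 2 * (1 - se) ^+ n.-1.
    rewrite -expRM_natl (_ : 2 * - (8 * n%:R)^-1 = - (4 * n%:R)^-1)//.
    by field; rewrite gt_eqF.
  have [f0 hv] := vol_dplus_le posdef (colA_neq0 j) f_eq1 n0 se1 (expR_ge0 _) phi0 hphi'.
  by apply: Or33; split=> //; exact: dplus_ge0.
Qed.
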